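(* There are only finitely many positive integers $n$ for which $\overline{F}_n$ is an integer, and the largest such $n$ is $n=58$.
   Context: For a positive integer $n$, $\overline{F}_n=\Big(\prod_{1\le h\le k\le n,\ \gcd(h,k)=1}\frac{h}{k}\Big)^{-1}$ is the reciprocal of the product of all nonzero Farey fractions of order $n$ (a positive rational number). *)

(* Defs.v *)
From mathcomp Require Import all_boot all_order all_algebra.
Set Implicit Arguments. Unset Strict Implicit. Unset Printing Implicit Defensive.
Import Order.TTheory GRing.Theory Num.Theory.
Local Open Scope ring_scope.

Definition farey_prod (n : nat) : rat :=
  \prod_(k < n.+1) \prod_(h < n.+1 | (0 < h)%N && (h <= k)%N && coprime h k)
     ((h%:R : rat) / (k%:R : rat)).

Definition Fbar (n : nat) : rat := (farey_prod n)^-1.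

Definition is_integer (x : rat) : Prop := exists z : int, x = z%:~R.

(* Main.v *)
(** For a prime [p] with [n < 3 p] and [8 p <= 3 n + 1], the only multiples of
    [p] up to [n] are [p] and [2 p], and counting coprime pairs shows that the
    order at [p] of the product of the denominators minus that of the numerators
    is [4 p - 1 - n - uphalf n < 0].  So [Fbar n] is not an integer as soon as
    there is a prime in [(n/3, 3n/8]].

    For large [n] such a prime comes from a Chebyshev-type argument with
    [x = 3 n].  Two lists of scales [k] are chosen so that
    [A z = sum_pos (z %/ k) - sum_neg (z %/ k)] satisfies [A z <= 0], except for
    [A 8 = 1] and a controlled excess at [z >= 856].  If no prime lies in
    [(x/9, x/8]], comparing valuations bounds the quotient of the products of
    the [(x %/ k)!] by [4 ^ (excess)], with lcm(1, ..., m) <= 4 ^ m; Stirling-type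
    bounds show that this quotient is larger.  A chain of primes of ratio
    at most 9/8 and a few direct computations settle the remaining [n]. *)

Require Import Defs.
From Stdlib Require Import NArith.
From mathcomp Require Import all_boot all_order all_algebra.
From mathcomp Require Import reals exp Rstruct.
From mathcomp Require Import zify ring lra.

Set Implicit Arguments. Unset Strict Implicit. Unset Printing Implicit Defensive.
Import Order.TTheory GRing.Theory Num.Theory.

(** * Orders of [Fbar n] at a prime *)

(** Stated for any monoid law, as it serves both the product of the fractions and the sums of
    valuations. *)
Lemma big_farey_row (T : Type) (idx : T) (op : Monoid.law idx) (n k : nat) (F : nat -> T) :
  k <= n -> \big[op/idx]_(h < n.+1 | (0 < h) && (h <= k) && coprime h k) F h =
  \big[op/idx]_(1 <= h < k.+1 | coprime h k) F h.
Proof.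
move=> lekn.
rewrite -(big_mkord (fun h => (0 < h) && (h <= k) && coprime h k) F).
rewrite big_ltn_cond //= (@big_cat_nat _ _ _ k.+1) //=.
rewrite [X in op _ X]big_nat_cond [X in op _ X]big1 ?Monoid.mulm1.
  rewrite big_nat_cond [RHS]big_nat_cond; apply: eq_bigl => h; lia.
by move=> h /andP[/andP[lt_h _]]; lia.
Qed.

Definition farey_product (f : nat -> nat -> nat) (n : nat) : nat :=
  \prod_(k < n.+1) \prod_(1 <= h < k.+1 | coprime h k) f h k.
Definition farey_num := farey_product (fun h k => h).
Definition farey_den := farey_product (fun h k => k).

Lemma farey_num_gt0 n : 0 < farey_num n.
Proof.
apply: prodn_gt0 => k; rewrite big_nat_cond; apply: prodn_cond_gt0 => h; lia.
Qed.

Lemma farey_den_gt0 n : 0 < farey_den n.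
Proof.
apply: prodn_gt0 => k; rewrite big_nat_cond; apply: prodn_cond_gt0 => h; lia.
Qed.

Lemma FbarE n : Fbar n = ((farey_den n)%:R / (farey_num n)%:R)%R.
Proof.
rewrite /Fbar -[RHS]invrK invf_div; congr (_^-1)%R.
rewrite /farey_prod /farey_num /farey_den /farey_product !natr_prod -prodf_div.
apply: eq_bigr => k _; rewrite !natr_prod -prodf_div.
by rewrite -(@big_farey_row _ _ _ n k (fun h => (h%:R / k%:R)%R)) // -ltnS.
Qed.

Lemma FbarP n : is_integer (Fbar n) <-> farey_num n %| farey_den n.
Proof.
have n0 : ((farey_num n)%:R != 0 :> rat)%R by rewrite pnatr_eq0 -lt0n farey_num_gt0.
rewrite FbarE; split=> [[z e]|/dvdnP[q ->]].
- have {}e : ((farey_den n)%:Z%:~R = (z * (farey_num n)%:Z)%:~R :> rat)%R.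
    by rewrite intrM -e -!pmulrn mulfVK.
  have /eqP := e; rewrite eqr_int => /eqP {}e.
  have /(congr1 absz) := e; rewrite abszM !absz_nat => ->.
  exact: dvdn_mull.
- by exists q%:Z%R; rewrite natrM mulfK // -pmulrn.
Qed.

Definition farey_val (v : nat -> nat -> nat) (n : nat) : nat :=
  \sum_(k < n.+1) \sum_(1 <= h < k.+1 | coprime h k) v h k.

Lemma logn_big (I : Type) (r : seq I) (P : pred I) (F : I -> nat) p :
  (forall i, P i -> 0 < F i) ->
  logn p (\prod_(i <- r | P i) F i) = \sum_(i <- r | P i) logn p (F i).
Proof.
move=> F0; suff [] : 0 < \prod_(i <- r | P i) F i /\
  logn p (\prod_(i <- r | P i) F i) = \sum_(i <- r | P i) logn p (F i) by [].
elim/big_rec2: _ => [|i y x Pi [x0 <-]]; first by rewrite logn1.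
by rewrite muln_gt0 F0 // x0 lognM ?F0.
Qed.

Lemma logn_farey_product f p n : (forall h k, 0 < h -> h <= k -> 0 < f h k) ->
  logn p (farey_product f n) = farey_val (fun h k => logn p (f h k)) n.
Proof.
move=> f0; rewrite /farey_product logn_big => [|k _].
  apply: eq_bigr => k _; rewrite big_nat_cond logn_big -?big_nat_cond // => h.
  by case/andP=> /andP[h0 hk] _; apply: f0.
rewrite big_nat_cond; apply: prodn_cond_gt0 => h /andP[/andP[h0 hk] _]; exact: f0.
Qed.

(** Plain lists, for evaluation by [vm_compute]. *)
Lemma farey_valE v n : farey_val v n =
  sumn [seq sumn [seq v h k | h <- iota 1 k & coprime h k] | k <- iota 0 n.+1].
Proof.
rewrite sumnE big_map /farey_val 
  -(big_mkord xpredT (fun k => \sum_(1 <= h < k.+1 | coprime h k) v h k)).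
rewrite /index_iota subn0; apply: eq_bigr => k _.
by rewrite sumnE big_map big_filter subn1.
Qed.

Definition farey_ord_neg p n :=
  farey_val (fun h k => logn p k) n < farey_val (fun h k => logn p h) n.

Lemma not_integer_Fbar p n : farey_ord_neg p n -> ~ is_integer (Fbar n).
Proof.
rewrite /farey_ord_neg => lt_v /FbarP /(dvdn_leq_log p (farey_den_gt0 n)).
by rewrite !logn_farey_product //; [rewrite leqNgt lt_v | lia].
Qed.

Lemma integer_Fbar58 : is_integer (Fbar 58).
Proof.
apply/FbarP; apply/dvdn_partP; first exact: farey_num_gt0.
move=> p; rewrite mem_primes => /and3P[pp _ _]; rewrite p_part pfactor_dvdn ?farey_den_gt0 //.
rewrite !logn_farey_product //; last by lia.
(* Numerators are at most 58, so the left side vanishes at primes from 59 on; the smaller primes are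
   computed. *)
case: (ltnP p 59) => [ltp|lep]; last first.
  rewrite {1}/farey_val big1 // => k _; rewrite big_nat_cond big1 // => h.
  by case/andP=> /andP[_ lt_h] _; rewrite ltn_log0 //; have := ltn_ord k; lia.
rewrite !farey_valE.
have : all (fun p => sumn [seq sumn [seq logn p h | h <- iota 1 k & coprime h k] | k <- iota 0 59]
  <= sumn [seq sumn [seq logn p k | h <- iota 1 k & coprime h k] | k <- iota 0 59])
  [seq p <- iota 0 59 | prime p] by vm_compute.
by move/allP; apply; rewrite mem_filter pp mem_iota.
Qed.

(* The [n] between 59 and 98 that are not handled by one of the primes 23, 29, 31. *)
Definition small_range : seq nat := iota 59 2 ++ iota 69 8 ++ iota 93 6.

(** For the [n] in [small_range] no prime meets [n < 3 * p] and [8 * p <= 3 * n + 1]; smaller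
    primes, with more multiples up to [n], are checked by computation. *)
Definition small_witness n :=
  if n <= 60 then 13 else if n <= 76 then 11 else if n == 93 then 5 else 11.

Lemma farey_ord_neg_small n : n \in small_range ->
  farey_ord_neg (small_witness n) n.
Proof.
rewrite /farey_ord_neg !farey_valE; move: n; apply/allP.
by vm_compute.
Qed.

(** * Counting coprime pairs at a prime above n/3 *)

Lemma sum_pred1_le n c : \sum_(k < n) (k == c :> nat) <= 1.
Proof.
case: (ltnP c n) => [ltc|lec]; last first.
  by rewrite big1 // => k _; apply/eqP; rewrite eqb0; have := ltn_ord k; lia.
rewrite (bigD1 (Ordinal ltc)) //= eqxx big1 // => k.
by rewrite -val_eqE /= => /negbTE ->.
Qed.

Lemma sum_odd m : \sum_(k < m) odd k = m./2.
Proof.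
elim: m => [|m IH]; first by rewrite big_ord0.
rewrite big_ord_recr /= IH; lia.
Qed.

Lemma farey_row_totient k : 1 < k -> \sum_(1 <= h < k.+1 | coprime h k) 1 = totient k.
Proof.
move=> k1; rewrite totient_count_coprime big_mkcond big_nat_recr /=; last by lia.
have -> : coprime k k = false by rewrite /coprime gcdnn; lia.
rewrite addn0 [RHS]big_ltn; last by lia.
have -> : coprime k 0 = false by rewrite /coprime gcdn0; lia.
by rewrite add0n; apply: eq_bigr => h _; rewrite coprime_sym; case: ifP.
Qed.

Lemma logn_small p k : prime p -> 0 < k < p ^ 2 -> logn p k = (p %| k).
Proof.
move=> pp /andP[k0 ltk].
have : logn p k < 2.
  by rewrite ltnNge -pfactor_dvdn //; apply/negP => /(dvdn_leq k0); rewrite leqNgt ltk.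
have := logn_gt0 p k; rewrite mem_primes pp k0 /=.
by case: (p %| k); case: (logn p k) => [|[]].
Qed.

Lemma dvdn_lt3 p k : 0 < k < 3 * p -> (p %| k) = (k == p) || (k == 2 * p).
Proof.
move=> k3; apply/dvdnP/orP => [[m e]|[/eqP ->|/eqP ->]]; last 2 first.
- by exists 1; rewrite mul1n.
- by exists 2.
rewrite e in k3 *; have : 0 < m < 3 by nia.
by case: m {e} k3 => [|[|[|m]]] // _ _; [left; rewrite mul1n | right].
Qed.

Lemma lt3_sqr p n k : 2 < p -> n < 3 * p -> k <= n -> k < p ^ 2.
Proof. nia. Qed.

(** Only the rows [k = p] and [k = 2 * p] contribute, each at most [totient k = p.-1] terms of order
    one. *)
Lemma farey_den_val_le p n : prime p -> 2 < p -> n < 3 * p ->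
  farey_val (fun h k => logn p k) n <= 2 * p.-1.
Proof.
move=> pp p3 ltn3p; have lt_sq := lt3_sqr p3 ltn3p.
have row (k : 'I_n.+1) : \sum_(1 <= h < k.+1 | coprime h k) logn p k <=
    ((k == p :> nat) + (k == 2 * p :> nat)) * p.-1.
  have ltk := ltn_ord k; case: (posnP k) => [->|k0].
    by rewrite big_geq.
  rewrite logn_small ?k0 ?lt_sq // dvdn_lt3; last by rewrite k0; lia.
  case: eqP => [->|_] /=.
    by rewrite farey_row_totient ?totient_prime; lia.
  case: eqP => [->|_] /=; last by rewrite big1.
  rewrite farey_row_totient; last by lia.
  rewrite totient_coprime; last by rewrite prime_coprime // dvdn_prime2 //; lia.
  by rewrite (totient_prime pp) (_ : totient 2 = 1) //; lia.
apply: leq_trans (leq_sum _ (fun k _ => row k)) _.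
rewrite -big_distrl /= leq_mul2r big_split /=; apply/orP; right.
by rewrite -[2]/(1 + 1) leq_add ?sum_pred1_le.
Qed.

(** The numerator [p] pairs with the [k] in [[p, n]] other than [p] and [2 * p], and [2 * p] pairs
    with the odd [k] in [[2 * p, n]], none of which is a multiple of [p] as [n < 3 * p]. *)
Lemma farey_num_val_ge p n : prime p -> 2 < p -> n < 3 * p -> 2 * p <= n ->
  n - p - 1 + (uphalf n - p) <= farey_val (fun h k => logn p h) n.
Proof.
move=> pp p3 ltn3p le2pn; have lt_sq := lt3_sqr p3 ltn3p.
pose row h := \sum_(k < n.+1) ((0 < h) && (h <= k) && coprime h k).
have -> : farey_val (fun h k => logn p h) n = \sum_(h < n.+1) logn p h * row h.
  transitivity (\sum_(k < n.+1) \sum_(h < n.+1)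
      logn p h * ((0 < h) && (h <= k) && coprime h k)).
    apply: eq_bigr => k _; rewrite -(@big_farey_row _ _ _ n k (logn p)) -1?ltnS //.
    by rewrite big_mkcond; apply: eq_bigr => h _; case: ifP; rewrite ?muln1 ?muln0.
  by rewrite exchange_big; apply: eq_bigr => h _; rewrite big_distrr.
have ltp : p < n.+1 by lia.
have lt2p : 2 * p < n.+1 by lia.
rewrite (bigD1 (Ordinal ltp)) //= (bigD1 (Ordinal lt2p)) /=; last first.
  by rewrite -val_eqE /=; lia.
rewrite !logn_small ?lt_sq ?dvdnn ?dvdn_mull // ?mul1n; try lia.
rewrite addnA; apply: leq_trans (leq_addr _ _); apply: leq_add.
- have : \sum_(k < n.+1) (p <= k) <= row p + (1 + 1).
    apply: leq_trans (leq_add (leqnn _)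
      (leq_add (sum_pred1_le n.+1 p) (sum_pred1_le n.+1 (2 * p)))).
    rewrite -!big_split /=; apply: leq_sum => k _; have ltk := ltn_ord k.
    case: (leqP p k) => // lepk; rewrite prime_coprime // dvdn_lt3; last lia.
    by rewrite prime_gt0 //; case: (_ == p); case: (_ == 2 * p).
  have : \sum_(k < n.+1) ((p <= k) + (k < p)) = n.+1.
    rewrite -[RHS]card_ord -sum1_card; apply: eq_bigr => k _; case: leqP => //.
  rewrite big_split /=.
  have : \sum_(k < n.+1) (k < p) = p.
    by rewrite -big_mkcond /= big_ord_narrow ?sum1_card ?card_ord //; lia.
  move: (row p) (\sum_(k < n.+1) (p <= k)) (\sum_(k < n.+1) (k < p)) => a b c; lia.
- have : \sum_(k < n.+1) (odd k && (2 * p <= k)) <= row (2 * p).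
    apply: leq_sum => k _; have ltk := ltn_ord k.
    case: (leqP (2 * p) k) => lek; rewrite ?andbF // andbT.
    case ok : (odd k) => //; rewrite coprimeMl coprime2n ok prime_coprime // dvdn_lt3; last lia.
    have /negbTE -> : k != p :> nat by lia.
    have /negbTE -> : k != 2 * p :> nat by lia.
    by rewrite muln_gt0 (prime_gt0 pp).
  (* There are [uphalf n] odd numbers up to [n], and [p] of them lie below [2 * p]. *)
  have e : \sum_(k < n.+1) odd k =
      \sum_(k < n.+1) (odd k && (2 * p <= k)) + \sum_(k < n.+1 | k < 2 * p) odd k.
    rewrite [X in _ = _ + X]big_mkcond -big_split; apply: eq_bigr => k _ /=.
    by case: leqP; case: odd.
  have : \sum_(k < n.+1 | k < 2 * p) odd k = p.
    rewrite big_ord_narrow; first by lia.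
    by move=> h; rewrite sum_odd; lia.
  rewrite sum_odd in e; move: e.
  move: (row (2 * p)) (\sum_(k < n.+1) (odd k && (2 * p <= k)))
    (\sum_(k < n.+1 | k < 2 * p) odd k) => a b c; lia.
Qed.

(** The two counts compare strictly when [4 * p <= n + uphalf n], and twice the right side is
    [3 * n] or [3 * n + 1] according to parity. *)
Lemma farey_ord_neg_prime p n : prime p -> 2 < p -> n < 3 * p ->
  8 * p <= 3 * n + 1 -> farey_ord_neg p n.
Proof.
move=> pp p3 ltn3p le8; have := farey_den_val_le pp p3 ltn3p.
have := farey_num_val_ge pp p3 ltn3p ltac:(lia).
rewrite /farey_ord_neg; lia.
Qed.

(** * Primes in short intervals: moderate size *)

(** Binary integers keep [vm_compute] fast; exhausted fuel gives [false], so acceptance is sound for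
    any fuel. *)
Fixpoint no_divisor_from (fuel : nat) (d p : N) : bool :=
  (p <? d * d)%num ||
  if fuel is fuel'.+1 then
    ~~ (p mod d =? 0)%num && no_divisor_from fuel' (N.succ d) p
  else false.

Lemma no_divisor_fromP fuel d p q : no_divisor_from fuel d p ->
  N.to_nat d <= q -> 1 < q -> q * q <= N.to_nat p -> ~~ (q %| N.to_nat p).
Proof.
elim: fuel d => [|fuel IH] d /=; first by rewrite orbF => /N.ltb_lt; nia.
case/orP=> [/N.ltb_lt|/andP[nd /IH{}IH]]; first by nia.
rewrite leq_eqVlt => /predU1P[ed|lt_d] q1 leq_q; last by apply: IH => //; lia.
apply: contra nd => /dvdnP[m e]; apply/N.eqb_eq.
have -> : p = (N.of_nat m * d)%num by nia.
by apply: N.Div0.mod_mul.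
Qed.

Definition trial_prime (p : N) : bool := (1 <? p)%num && no_divisor_from 2000 2 p.

Lemma trial_primeP p : trial_prime p -> prime (N.to_nat p).
Proof.
case/andP=> /N.ltb_lt p1 nd; apply/negPn/negP => /primePns[|[q [pq le_q dv]]]; first by lia.
have q1 := prime_gt1 pq; move: dv; apply/negP.
by apply: no_divisor_fromP nd _ _ _ => //; lia.
Qed.

(** A prime [p] serves [n] up to [3 * p - 1]; from [n = 3 * p] on, the link [8 * q <= 9 * p + 1]
    makes [q] small enough. *)
Fixpoint prime_chain (p : N) (s : seq N) : bool :=
  trial_prime p &&
  if s is q :: s' then (8 * q <=? 9 * p + 1)%num && prime_chain q s' else true.

Lemma prime_chainP p s n : prime_chain p s -> 8 * N.to_nat p <= 3 * n + 1 ->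
  n < 3 * N.to_nat (last p s) ->
  exists q, [/\ prime q, n < 3 * q & 8 * q <= 3 * n + 1].
Proof.
elim: s p => [|q s IH] p.
  by rewrite /= andbT => /trial_primeP pp lo hi; exists (N.to_nat p).
rewrite last_cons => /andP[/trial_primeP pp /andP[/N.leb_le le_q /IH{}IH]] lo hi.
case: (ltnP n (3 * N.to_nat p)) => [lt_n|le_n]; first by exists (N.to_nat p).
by apply: IH => //; lia.
Qed.

Definition chain_primes : seq N := [::
  41; 43; 47; 53; 59; 61; 67; 73; 79; 89; 97; 109; 113; 127; 139; 151; 167;
  181; 199; 223; 251; 281; 313; 349; 389; 433; 487; 547; 613; 683; 761; 853;
  953; 1069; 1201; 1327; 1493; 1669; 1877; 2111; 2371; 2663; 2971; 3331;
  3739; 4201; 4723; 5309; 5953; 6691; 7523; 8461; 9511; 10691; 12011; 13499;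
  15173; 17053; 19183; 21577; 24251; 27281; 30689; 34519; 38833; 43669;
  49123; 55259; 62143; 69911; 78649; 88471; 99529; 111959; 125941; 141679;
  159389; 179287; 201683; 226871; 255217; 287117; 323003; 363373; 408787;
  459883; 517367; 582037; 654781; 736607; 828677; 932257]%num.

Lemma prime_near_small n : 99 <= n -> n < 3 * (900 * 1000) ->
  exists q, [/\ prime q, n < 3 * q & 8 * q <= 3 * n + 1].
Proof.
(* The prime 37 works from [n = 99] on, since 8 * 37 = 296 <= 298. *)
move=> n99 ltn; have c : prime_chain 37 chain_primes by vm_compute.
apply: (prime_chainP c); first by lia.
by apply: leq_trans ltn _; rewrite /=; lia.
Qed.

(** * Factorial quotients and valuations *)

Lemma dvdn_logn m n : 0 < m -> 0 < n ->
  (forall p, prime p -> logn p m <= logn p n) -> m %| n.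
Proof.
move=> m0 n0 le_mn; apply/dvdn_partP => // p.
by rewrite mem_primes => /and3P[pp _ _]; rewrite p_part pfactor_dvdn // le_mn.
Qed.

(** Legendre's formula with a free cutoff [B], so that the sums for several factorials can be
    compared term by term. *)
Lemma logn_fact_bounded p n B : prime p -> n < B ->
  logn p n`! = \sum_(1 <= i < B) n %/ p ^ i.
Proof.
move=> pp ltnB; rewrite logn_fact // (@big_cat_nat _ _ _ n.+1 1 B) //=.
rewrite [X in _ = _ + X]big_nat_cond [X in _ = _ + X]big1 ?addn0 // => i /andP[/andP[lt_ni _] _].
by rewrite divn_small // (ltn_trans lt_ni) // ltn_expl // prime_gt1.
Qed.

(** For odd [m] the central coefficient occurs twice in the row of sum [2 ^ m], which saves a factor
    2. *)
Lemma leq_bin_half m : 'C(m, m./2) <= 4 ^ m./2.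
Proof.
have sum_bin : \sum_(i < m.+1) 'C(m, i) = 2 ^ m.
  rewrite (expnDn 1 1 m); apply: eq_bigr => i _.
  by rewrite !exp1n !muln1.
have le_half : m./2 <= m by rewrite -{2}(odd_double_half m) -addnn; lia.
have e4 : 4 ^ m./2 = 2 ^ m./2.*2 by rewrite -muln2 mulnC expnM.
rewrite e4; have := odd_double_half m; case: (boolP (odd m)) => [om|_] /= em.
- have le2 : 'C(m, m./2) + 'C(m, m./2.+1) <= 2 ^ m.
    have lt1 : m./2 < m.+1 by lia.
    have lt2 : m./2.+1 < m.+1 by lia.
    rewrite -sum_bin (bigD1 (Ordinal lt1)) //= leq_add2l.
    by rewrite (bigD1 (Ordinal lt2)) /= ?leq_addr // -val_eqE /=; lia.
  have e : 'C(m, m./2.+1) = 'C(m, m./2).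
    by rewrite -bin_sub; [congr 'C(_, _); lia | lia].
  have e2 : 2 ^ m = 2 * 2 ^ m./2.*2 by rewrite -expnS; congr (2 ^ _); lia.
  by move: le2; rewrite e e2; lia.
- have lt1 : m./2 < m.+1 by lia.
  rewrite add0n in em; rewrite em -sum_bin (bigD1 (Ordinal lt1)) //=.
  exact: leq_addr.
Qed.

(* [L] plays the role of lcm(1, ..., m): it is built from
   lcm(1, ..., m) | lcm(1, ..., uphalf m) * 'C(m, m./2). *)
Lemma lcm_bound m : exists2 L, 0 < L <= 4 ^ m &
  forall p B, prime p -> m < B -> \sum_(1 <= i < B) (p ^ i <= m) <= logn p L.
Proof.
elim/ltn_ind: m => m IH.
case: (leqP m 1) => [le_m1|lt1m].
  exists 1; first by rewrite expn_gt0.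
  move=> p B pp _; rewrite logn1 big_nat_cond big1 // => i /andP[/andP[i1 _] _].
  have : 1 < p ^ i by rewrite -(exp1n i) ltn_exp2r // prime_gt1.
  by case: (leqP (p ^ i) m) => //; lia.
have em : m = m./2 + uphalf m by rewrite uphalf_half; have := odd_double_half m; lia.
have le_hu : m./2 <= uphalf m by rewrite uphalf_half; lia.
have [L /andP[L0 leL] HL] := IH (uphalf m) ltac:(rewrite uphalf_half; lia).
have le_hm : m./2 <= m by lia.
have C0 : 0 < 'C(m, m./2) by rewrite bin_gt0.
exists (L * 'C(m, m./2)).
  rewrite muln_gt0 L0 C0 /= {3}em addnC expnD leq_mul //.
  exact: leq_bin_half.
move=> p B pp ltmB; rewrite lognM //.
have := HL p B pp ltac:(lia).
set S := \sum_(_ <= _ < _) _ => HS.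
apply: leq_trans (leq_add HS (leqnn _)).
have /(congr1 (logn p)) := bin_fact le_hm.
have -> : m - m./2 = uphalf m by lia.
rewrite !lognM ?muln_gt0 ?fact_gt0 // !(@logn_fact_bounded p _ B) //; try lia.
move=> e; rewrite -(leq_add2r (\sum_(1 <= i < B) m./2 %/ p ^ i +
  \sum_(1 <= i < B) uphalf m %/ p ^ i)).
rewrite -addnA e /S -!big_split /=.
apply: leq_sum => i _.
have q0 : 0 < p ^ i by rewrite expn_gt0 prime_gt0.
(* Powers up to [uphalf m] are counted by [L]. A power in [(uphalf m, m]] is counted by the
   binomial: the halves have quotient 0 and [m] a positive one. *)
case: (leqP (p ^ i) (uphalf m)) => [le_q|lt_q].
  have -> : (p ^ i <= m) by lia.
  by rewrite leq_add2l [X in _ <= X %/ _]em leq_divRL // mulnDl leq_add ?leq_trunc_div.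
rewrite (@divn_small m./2) ?(@divn_small (uphalf m)) //; last by lia.
by case: (leqP (p ^ i) m) => // le_qm; have := divn_gt0 m q0; rewrite le_qm; lia.
Qed.

(* These scales were found by linear programming over 5-smooth integers: the sums
   of 1/k over the two lists agree, and the sums of ln k / k differ by more than
   the cost of the excess in [floor_sum_le]. *)
Definition pos_scales :=
  [:: 8; 18; 27; 45; 48; 64; 80; 108; 120; 160; 162; 300; 384; 405; 450].
Definition neg_scales :=
  [:: 9; 16; 24; 40; 54; 54; 81; 90; 128; 135; 150; 225; 432].

Definition floor_sum (s : seq nat) (z : nat) := \sum_(k <- s) z %/ k.

Definition floor_factprod (s : seq nat) (x : nat) := \prod_(k <- s) (x %/ k)`!.

Lemma floor_factprod_gt0 s x : 0 < floor_factprod s x.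
Proof. by rewrite prodn_gt0 // => k; exact: fact_gt0. Qed.

(** Legendre's formula combined with [(x %/ k) %/ p ^ i = (x %/ p ^ i) %/ k]. *)
Lemma logn_floor_factprod s p x B : prime p -> x < B ->
  logn p (floor_factprod s x) = \sum_(1 <= i < B) floor_sum s (x %/ p ^ i).
Proof.
move=> pp ltxB; elim: s => [|k s IH].
  by rewrite /floor_factprod big_nil logn1 big1 // => i _; rewrite /floor_sum big_nil.
rewrite /floor_factprod big_cons lognM ?fact_gt0 ?floor_factprod_gt0 // -/(floor_factprod s x) IH.
rewrite (@logn_fact_bounded p _ B) //; last exact: leq_ltn_trans (leq_div _ _) ltxB.
rewrite -big_split; apply: eq_bigr => i _ /=.
by rewrite /floor_sum big_cons divnAC.
Qed.

(* [clock s z] stores, for each scale [k], the number of unit steps left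
   before [z %/ k] next jumps, minus one. *)
Definition clock (s : seq nat) (z : nat) := [seq (k.-1 - z %% k, k.-1) | k <- s].

(** Stepping counters spares the divisions in the check of all [z] up to 24000. *)
Fixpoint tick (l : seq (nat * nat)) : seq (nat * nat) * nat :=
  if l is (d, m) :: l' then
    let: (t, c) := tick l' in
    if d is d'.+1 then ((d', m) :: t, c) else ((m, m) :: t, c.+1)
  else ([::], 0).

Lemma tickE s z : all (leq 1) s ->
  tick (clock s z) = (clock s z.+1, floor_sum s z.+1 - floor_sum s z) /\
  floor_sum s z <= floor_sum s z.+1.
Proof.
elim: s => [|k s IH] /=; first by rewrite /floor_sum !big_nil.
move=> /andP[k0 /IH[e le]].
have lt_m := ltn_pmod z k0.
have edz := divn_eq z k.
rewrite e /floor_sum !big_cons -/(floor_sum s z) -/(floor_sum s z.+1).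
case: (ltnP (z %% k).+1 k) => lt_k.
  have ed : z.+1 %/ k = z %/ k.
    by rewrite {1}edz -addnS divnMDl // (divn_small lt_k) addn0.
  have emod : z.+1 %% k = (z %% k).+1 by rewrite {1}edz -addnS modnMDl modn_small.
  rewrite ed emod; have -> : k.-1 - z %% k = (k.-1 - (z %% k).+1).+1 by lia.
  by split; [congr (_, _); lia | lia].
have es : (z %% k).+1 = k by lia.
have ed : z.+1 %/ k = (z %/ k).+1.
  by rewrite {1}edz -addnS es -mulSnr mulnK.
have emod : z.+1 %% k = 0 by rewrite {1}edz -addnS es -mulSnr modnMl.
rewrite ed emod; have -> : k.-1 - z %% k = 0 by lia.
by rewrite subn0; split; [congr (_, _); lia | lia].
Qed.

(* The slack [e] satisfies [floor_sum t z + 2 = floor_sum s z + e]. *)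
Fixpoint run (bs : seq nat) (P Q : seq (nat * nat)) (e : nat) : bool :=
  if bs is b :: bs' then
    let: (P', a) := tick P in let: (Q', c) := tick Q in
    let e' := c + e - a in
    [&& a <= c + e, 2 <= e' + b & run bs' P' Q' e']
  else true.

(** As [e] is 2 minus the excess of [s] over [t], the test [2 <= e' + b] bounds the new excess by
    [b]; the shift by 2 keeps the slack natural. *)
Lemma runP bs s t z e : all (leq 1) s -> all (leq 1) t ->
  floor_sum t z + 2 = floor_sum s z + e -> run bs (clock s z) (clock t z) e ->
  forall i, i < size bs ->
    floor_sum s (z + i.+1) <= floor_sum t (z + i.+1) + nth 0 bs i.
Proof.
move=> s1 t1; elim: bs z e => [|b bs IH] z e //= He.
have [-> les] := tickE z s1; have [-> let_] := tickE z t1.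
move=> /and3P[le_ac le_b /IH{}IH] [|i] /= lt_i.
  by rewrite addn1; lia.
by rewrite addnS -addSn; apply: IH => //; lia.
Qed.

Lemma nth_phases a b c d f i :
  nth 0 (nseq a 0 ++ nseq b 1 ++ nseq c 0 ++ nseq d 1 ++ nseq f 2) i <=
  (a <= i < a + b) + (a + b + c <= i) + (a + b + c + d <= i).
Proof.
rewrite nth_cat size_nseq; case: ltnP => h1; first by rewrite nth_nseq h1; lia.
rewrite nth_cat size_nseq; case: ltnP => h2; first by rewrite nth_nseq h2; lia.
rewrite nth_cat size_nseq; case: ltnP => h3; first by rewrite nth_nseq h3; lia.
rewrite nth_cat size_nseq; case: ltnP => h4; first by rewrite nth_nseq h4; lia.
by rewrite nth_nseq; case: ifP => _; lia.
Qed.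

Lemma floor_sum0 s : floor_sum s 0 = 0.
Proof. by rewrite /floor_sum big1 // => k _; rewrite div0n. Qed.

(** Equal sums of [1 / k] cancel the linear terms, so the difference is bounded; 10 = 1 + 1 + 8 is
    what [floor_sum_le] allows from 24000 on. *)
Lemma floor_sum_crude z :
  floor_sum pos_scales z <= floor_sum neg_scales z + 10.
Proof.
rewrite /floor_sum /pos_scales /neg_scales !(big_cons, big_nil).
lia.
Qed.

Lemma floor_sum_le z : floor_sum pos_scales z <=
  floor_sum neg_scales z + (z == 8) + (856 <= z) + (2408 <= z) + 8 * (24 * 1000 <= z).
Proof.
case: (leqP (24 * 1000) z) => [le_z|lt_z].
  have := floor_sum_crude z.
  lia.
case: z lt_z => [|z] lt_z; first by rewrite !floor_sum0.
(* Entry [i] bounds the excess at [z = i + 1]: 1 at 8, then 0 up to 855, 1 up to 2407, and 2 up to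
   24000. *)
pose bs := nseq 7 0 ++ nseq 1 1 ++ nseq 847 0 ++ nseq 1552 1 ++ nseq (24 * 1000 - 2407) 2.
have r : run bs (clock pos_scales 0) (clock neg_scales 0) 2 by vm_compute.
have e0 : floor_sum neg_scales 0 + 2 = floor_sum pos_scales 0 + 2 by rewrite !floor_sum0.
have := @runP bs pos_scales neg_scales 0 2 isT isT e0 r z.
have sz : size bs = 24 * 1000.
  by rewrite /bs !(size_cat, size_nseq); lia.
rewrite sz add0n => /(_ ltac:(lia)) /leq_trans; apply.
rewrite -!addnA leq_add2l; apply: leq_trans (nth_phases _ _ _ _ _ z) _.
lia.
Qed.

(* By [noq], an exponent with [x %/ p ^ i = 8] is at least 2, whence [p <= r], and
   there is at most one such exponent. *)
Lemma sum_eq8_le p x r B : prime p -> (forall q, prime q -> 8 * q <= x -> 9 * q <= x) ->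
  x < 8 * r.+1 ^ 2 -> \sum_(1 <= i < B) (x %/ p ^ i == 8) <= (p <= r).
Proof.
move=> pp noq ltx; have p1 := prime_gt1 pp.
have pX i : 0 < p ^ i by rewrite expn_gt0 ltnW.
have bnd i : x %/ p ^ i == 8 -> 8 * p ^ i <= x < 9 * p ^ i.
  by move=> /eqP e; have := divn_eq x (p ^ i); have := ltn_pmod x (pX i); rewrite e; lia.
elim: B => [|[|B] IH]; try by rewrite big_geq.
rewrite big_nat_recr //=; case e8 : (_ == 8); last by rewrite addn0.
have /andP[le8 lt9] := bnd _ e8.
rewrite big_nat_cond big1 => [|i /andP[/andP[i1 ltiB] _]].
  case: B => [|B] in IH e8 le8 lt9 *.
    by have := noq p pp; rewrite expn1 in le8 lt9; lia.
  suff -> : p <= r by [].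
  rewrite -ltnS -(@ltn_exp2r _ _ 2) //.
  have : p ^ 2 <= p ^ B.+2 by rewrite leq_exp2l.
  lia.
apply/eqP; rewrite eqb0; apply/negP => /bnd /andP[_].
(* Two powers with quotient 8 have ratio below 9/8, but distinct powers of [p] differ by a factor of
   at least 2. *)
have : p ^ i * 2 <= p ^ B.+1.
  apply: leq_trans (_ : p ^ i.+1 <= _); last by rewrite leq_exp2l.
  by rewrite expnSr leq_mul2l p1 orbT.
lia.
Qed.

(** The left side even divides the negative product times [L0 * L1 * L2 * L3 ^ 8]: an excess
    [Z <= x %/ p ^ i] means [p ^ i <= x %/ Z], which lcm(1, ..., x %/ Z) counts, and [L0] absorbs
    the quotient 8. *)
Lemma floor_factprod_le x r : (forall q, prime q -> 8 * q <= x -> 9 * q <= x) ->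
  x < 8 * r.+1 ^ 2 ->
  floor_factprod pos_scales x <= floor_factprod neg_scales x *
    4 ^ (r + x %/ 856 + x %/ 2408 + 8 * (x %/ (24 * 1000))).
Proof.
move=> noq ltx.
have [L0 /andP[L00 L01] HL0] := lcm_bound r.
have [L1 /andP[L10 L11] HL1] := lcm_bound (x %/ 856).
have [L2 /andP[L20 L21] HL2] := lcm_bound (x %/ 2408).
have [L3 /andP[L30 L31] HL3] := lcm_bound (x %/ (24 * 1000)).
have le_prod : L0 * L1 * L2 * L3 ^ 8 <=
    4 ^ (r + x %/ 856 + x %/ 2408 + 8 * (x %/ (24 * 1000))).
  have -> : 8 * (x %/ (24 * 1000)) = x %/ (24 * 1000) * 8 by rewrite mulnC.
  by rewrite !expnD expnM !leq_mul // leq_exp2r.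
apply: leq_trans (leq_mul (leqnn (floor_factprod neg_scales x)) le_prod).
have L_gt0 : 0 < L0 * L1 * L2 * L3 ^ 8 by rewrite !muln_gt0 ?expn_gt0 L00 L10 L20 L30.
apply: dvdn_leq; first by rewrite muln_gt0 floor_factprod_gt0.
apply: dvdn_logn => [||p pp]; first exact: floor_factprod_gt0.
  by rewrite muln_gt0 floor_factprod_gt0.
pose B := (x + r).+2.
have ltxB : x < B by rewrite /B ltnS leqW // leq_addr.
have sum_ind Z : 0 < Z -> \sum_(1 <= i < B) (Z <= x %/ p ^ i) =
    \sum_(1 <= i < B) (p ^ i <= x %/ Z).
  move=> Z0; apply: eq_bigr => i _; have q0 : 0 < p ^ i by rewrite expn_gt0 prime_gt0.
  by rewrite !leq_divRL // mulnC.
have ltdB Z : x %/ Z < B by exact: leq_ltn_trans (leq_div _ _) ltxB.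
rewrite (lognM _ (floor_factprod_gt0 _ _) L_gt0) (@lognM p (L0 * L1 * L2)) ?expn_gt0 ?L30 //;
  last by rewrite !muln_gt0 L00 L10 L20.
rewrite (@lognM p (L0 * L1)) ?muln_gt0 ?L00 // (@lognM p L0) // lognX.
rewrite !(@logn_floor_factprod _ p x B) //.
have h0 : \sum_(1 <= i < B) (x %/ p ^ i == 8) <= logn p L0.
  apply: leq_trans (sum_eq8_le _ pp noq ltx) _.
  apply: leq_trans (HL0 p B pp _); last by rewrite /B ltnS leqW // leq_addl.
  by rewrite big_ltn // expn1 leq_addr.
have h1 := HL1 p B pp (ltdB _); have h2 := HL2 p B pp (ltdB _); have h3 := HL3 p B pp (ltdB _).
rewrite -sum_ind // in h1; rewrite -sum_ind // in h2; rewrite -sum_ind // in h3.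
have := leq_mul (leqnn 8) h3; rewrite big_distrr /= => {}h3.
apply: leq_trans (leq_add (leqnn _) (leq_add (leq_add (leq_add h0 h1) h2) h3)).
rewrite -!big_split /=; apply: leq_sum => i _.
by have := floor_sum_le (x %/ p ^ i); rewrite !addnA.
Qed.

(** * Growth of the factorial quotient *)

Local Open Scope ring_scope.

Lemma ln_succ_bounds (R : realType) (m : nat) : (0 < m)%N ->
  (m.+1%:R)^-1 <= ln (m.+1%:R : R) - ln m%:R <= (m%:R)^-1.
Proof.
move=> m0; have mp : 0 < m%:R :> R by rewrite ltr0n.
have m1p : 0 < m.+1%:R :> R by rewrite ltr0n.
apply/andP; split.
- have h : -1 < - (m.+1%:R)^-1 :> R.
    by rewrite ltrN2 invf_lt1 // ltr1n.
  have := le_ln1Dx h.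
  have -> : 1 + - (m.+1%:R)^-1 = m%:R / m.+1%:R :> R.
    by rewrite -natr1; field; rewrite natr1 lt0r_neq0.
  by rewrite ln_div ?posrE // lerNr opprB.
- have h : -1 < (m%:R)^-1 :> R.
    by apply: lt_trans (_ : 0 < _); [lra | rewrite invr_gt0].
  have := le_ln1Dx h.
  have -> : 1 + (m%:R)^-1 = m.+1%:R / m%:R :> R.
    by rewrite -natr1; field; rewrite lt0r_neq0.
  by rewrite ln_div ?posrE.
Qed.

Lemma ln_fact_bounds (R : realType) (m : nat) : (0 < m)%N ->
  m%:R * ln m%:R - m%:R <= ln (m`!%:R : R) <= (m%:R + 1) * ln m%:R - m%:R + 1.
Proof.
elim: m => // m IH _; case: (posnP m) => [->|m0].
  by rewrite (_ : 1`! = 1)%N // ln1; lra.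
have /andP[lo hi] := IH m0; have /andP[dl du] := ln_succ_bounds R m0.
have mp : 0 < m%:R :> R by rewrite ltr0n.
rewrite factS natrM lnM ?posrE ?ltr0n ?fact_gt0 //.
move: dl du lo hi; rewrite -natr1.
set a := ln m%:R; set b := ln (_ + 1); set f := ln _ => dl du lo hi.
(* [e1] carries the induction for the lower bound, [e2] for the upper one. *)
have e1 : m%:R * (b - a) <= 1 by rewrite mulrC -ler_pdivlMr // div1r.
have e2 : 1 <= (m%:R + 1) * (b - a) by rewrite mulrC -ler_pdivrMr ?div1r //; lra.
apply/andP; split; nra.
Qed.

(** With [y = x / k], rounding [y] down changes [t ln t - t] by at most [ln y <= ln x]. *)
Lemma ln_fact_floor (R : realType) (x k : nat) : (0 < k <= x)%N ->
  x%:R / k%:R * (ln x%:R - 1 - ln k%:R) - ln x%:R <= ln ((x %/ k)`!%:R : R) <=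
  x%:R / k%:R * (ln x%:R - 1 - ln k%:R) + ln x%:R + 1.
Proof.
move=> /andP[k0 lekx]; set y : R := x%:R / k%:R.
have kp : 0 < k%:R :> R by rewrite ltr0n.
have xp : 0 < x%:R :> R by rewrite ltr0n (leq_trans k0).
have lnk : 0 <= ln (k%:R : R) by rewrite ln_ge0 // ler1n.
have m0 : (0 < x %/ k)%N by rewrite divn_gt0.
have /andP[lo hi] := ln_fact_bounds R m0.
move: m0 lo hi; set m := (x %/ k)%N => m0 lo hi.
have mp : 0 < m%:R :> R by rewrite ltr0n.
have lemy : m%:R <= y.
  by rewrite ler_pdivlMr // -natrM ler_nat leq_trunc_div.
have ltym : y < m%:R + 1.
  by rewrite ltr_pdivrMr // natr1 -natrM ltr_nat -ltn_divLR.
have yp : 0 < y by apply: lt_le_trans lemy.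
have lny : ln y = ln x%:R - ln k%:R by rewrite ln_div ?posrE.
have lnm0 : 0 <= ln (m%:R : R) by rewrite ln_ge0 // ler1n.
have lny0 : ln m%:R <= ln y by rewrite ler_ln ?posrE.
(* convexity of [t ln t - t], whose derivative is [ln t] *)
have h1 : y * (ln y - ln m%:R) >= y - m%:R.
  have h : -1 < m%:R / y - 1 by rewrite ltrBrDr addrC subrr divr_gt0.
  have := le_ln1Dx h; rewrite addrC subrK ln_div ?posrE // => e.
  have -> : y - m%:R = y * (1 - m%:R / y) by field; rewrite lt0r_neq0.
  by rewrite ler_pM2l //; lra.
have h2 : m%:R * (ln y - ln m%:R) <= y - m%:R.
  have h : -1 < y / m%:R - 1 by rewrite ltrBrDr addrC subrr divr_gt0.
  have := le_ln1Dx h; rewrite addrC subrK ln_div ?posrE // => e.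
  have -> : y - m%:R = m%:R * (y / m%:R - 1) by field; rewrite lt0r_neq0.
  by rewrite ler_pM2l //; lra.
have -> : ln x%:R - 1 - ln k%:R = ln y - 1 :> R by rewrite lny; lra.
apply/andP; split.
- have : (y - m%:R) * ln y <= ln y by rewrite ler_piMl; lra.
  nra.
- nra.
Qed.

Definition inv_sum (R : realType) (s : seq nat) : R := \sum_(k <- s) k%:R^-1.
Definition log_sum (R : realType) (s : seq nat) : R :=
  \sum_(k <- s) ln (k%:R : R) / k%:R.

Lemma ln_floor_factprod_bounds (R : realType) (s : seq nat) (x : nat) :
  all (fun k => 0 < k <= x)%N s ->
  x%:R * ((ln x%:R - 1) * inv_sum R s - log_sum R s) -
    (size s)%:R * (ln x%:R + 1) <= ln ((floor_factprod s x)%:R : R) <=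
  x%:R * ((ln x%:R - 1) * inv_sum R s - log_sum R s) +
    (size s)%:R * (ln x%:R + 1).
Proof.
elim: s => [|k s IH] /=.
  by rewrite /inv_sum /log_sum /floor_factprod !big_nil ln1; lra.
move=> /andP[kx /IH /andP[]]; have [k0 lekx] := andP kx.
have /andP[lo hi] := ln_fact_floor R kx.
rewrite /inv_sum /log_sum /floor_factprod !big_cons -/(floor_factprod s x).
rewrite natrM lnM ?posrE ?ltr0n ?fact_gt0 ?floor_factprod_gt0 //.
move: lo hi; rewrite -natr1.
set H := \sum_(_ <- _) _; set G := \sum_(_ <- _) _.
set f := ln (_`!%:R); set F := ln (floor_factprod _ _)%:R.
set X := x%:R; set K := k%:R; set L := ln X; set lk := ln K; set n := (size s)%:R.
have -> : X / K * (L - 1 - lk) = X * ((L - 1) * K^-1 - lk / K) by ring.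
have L0 : 0 <= L by rewrite ln_ge0 // ler1n (leq_trans k0).
move=> lo hi LO HI; apply/andP; split; nra.
Qed.

(* The triple [(a, b, c)] encodes [2 ^ a * 3 ^ b * 5 ^ c]; expressing the scales in
   this way reduces all the [ln k] to [ln 2], [ln 3] and [ln 5]. *)
Definition smooth (t : nat * nat * nat) : nat := (2 ^ t.1.1 * 3 ^ t.1.2 * 5 ^ t.2)%N.

Definition pos_triples : seq (nat * nat * nat) :=
  [:: (3, 0, 0); (1, 2, 0); (0, 3, 0); (0, 2, 1); (4, 1, 0); (6, 0, 0);
      (4, 0, 1); (2, 3, 0); (3, 1, 1); (5, 0, 1); (1, 4, 0); (2, 1, 2);
      (7, 1, 0); (0, 4, 1); (1, 2, 2)].
Definition neg_triples : seq (nat * nat * nat) :=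
  [:: (0, 2, 0); (4, 0, 0); (3, 1, 0); (3, 0, 1); (1, 3, 0); (1, 3, 0);
      (0, 4, 0); (1, 2, 1); (7, 0, 0); (0, 3, 1); (1, 1, 2); (0, 2, 2);
      (4, 3, 0)].

Lemma pos_smooth : pos_scales = map smooth pos_triples. Proof. by []. Qed.
Lemma neg_smooth : neg_scales = map smooth neg_triples. Proof. by []. Qed.

Lemma smoothE (R : realType) t :
  (smooth t)%:R = 2 ^+ t.1.1 * 3 ^+ t.1.2 * 5 ^+ t.2 :> R.
Proof. by rewrite !natrM !natrX. Qed.

Lemma ln_smooth (R : realType) t : ln ((smooth t)%:R : R) =
  t.1.1%:R * ln 2 + t.1.2%:R * ln 3 + t.2%:R * ln 5.
Proof.
rewrite smoothE !lnM ?posrE ?mulr_gt0 ?exprn_gt0 ?ltr0n //.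
by rewrite !lnXn ?ltr0n // -!(mulr_natl (ln _)).
Qed.

Lemma inv_sum_smooth (R : realType) ts : inv_sum R (map smooth ts) =
  foldr (fun t a => (2 ^+ t.1.1 * 3 ^+ t.1.2 * 5 ^+ t.2)^-1 + a) 0 ts.
Proof.
rewrite /inv_sum; elim: ts => [|t ts IH]; first by rewrite big_nil.
by rewrite map_cons big_cons IH smoothE.
Qed.

Lemma log_sum_smooth (R : realType) ts : log_sum R (map smooth ts) =
  foldr (fun t a => (t.1.1%:R * ln 2 + t.1.2%:R * ln 3 + t.2%:R * ln 5) /
    (2 ^+ t.1.1 * 3 ^+ t.1.2 * 5 ^+ t.2) + a) 0 ts.
Proof.
rewrite /log_sum; elim: ts => [|t ts IH]; first by rewrite big_nil.
by rewrite map_cons big_cons IH ln_smooth smoothE.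
Qed.

(** This cancels the [x ln x] terms of the two factorial products, leaving [x] times the gap between
    the [log_sum] values. *)
Lemma inv_sum_eq (R : realType) : inv_sum R pos_scales = inv_sum R neg_scales.
Proof.
rewrite pos_smooth neg_smooth.
rewrite !inv_sum_smooth.
rewrite /pos_triples /neg_triples.
cbn [foldr fst snd].
lra.
Qed.

Lemma log_sum_gap (R : realType) :
  log_sum R neg_scales - log_sum R pos_scales =
  ((31 * 1000 + 821) * ln 3 + 740 * ln 5 - (51 * 1000 + 46) * ln 2) / (2592 * 100).
Proof.
rewrite pos_smooth neg_smooth !log_sum_smooth /pos_triples /neg_triples.
cbn [foldr fst snd].
generalize (ln 2 : R) (ln 3 : R) (ln 5 : R).
move=> a b c; lra.
Qed.
(** A unit of excess costs [ln 4 = 2 ln 2]: the second summand pays for the excess per unit of [x],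
    and 429/10^6 is the margin. The ratios of logarithms come from [2 ^ 84 <= 3 ^ 53] and
    [2 ^ 65 <= 5 ^ 28]. *)
Lemma log_sum_gap_ge (R : realType) :
  (429 / 1000 / 1000 + 2 * (1 / 856 + 1 / 2408 + 8 / (24 * 1000)) : R) * ln 2 <=
  log_sum R neg_scales - log_sum R pos_scales.
Proof.
have l2 : 0 < ln 2 :> R by rewrite ln_gt0 // ltr1n.
have h3 : 84 * ln 2 <= 53 * ln 3 :> R.
  rewrite !mulr_natl -!lnXn ?ltr0n // ler_ln ?posrE ?exprn_gt0 ?ltr0n //.
  lra.
have h5 : 65 * ln 2 <= 28 * ln 5 :> R.
  rewrite !mulr_natl -!lnXn ?ltr0n // ler_ln ?posrE ?exprn_gt0 ?ltr0n //.
  lra.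
rewrite log_sum_gap; lra.
Qed.

Lemma ln2_ge_half (R : realType) : 1 / 2 <= ln 2 :> R.
Proof.
have h : -1 < - (1 / 2) :> R by lra.
have := le_ln1Dx h; have -> : 1 + - (1 / 2) = 2^-1 :> R by lra.
rewrite lnV ?posrE ?ltr0n //; lra.
Qed.

(** Here [ln x <= 3 ln 2 + 2 ln (r + 1)], and the last logarithm lies below its tangent at
    [1024 = 2 ^ 10]. The factor [ln 2], pulled out by [1 <= 2 ln 2], cancels in [growth_arith]. *)
Lemma ln_lt_sqrt (R : realType) (x r : nat) : (0 < x < 8 * r.+1 ^ 2)%N ->
  ln (x%:R : R) + 1 <= ln 2 * (23 + 4 * r.+1%:R / 1024).
Proof.
move=> /andP[x0 ltx]; have l2 := ln2_ge_half R.
have r0 : 0 < r.+1%:R :> R by rewrite ltr0n.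
have hx : ln (x%:R : R) <= ln (2 ^+ 3 * r.+1%:R ^+ 2).
  rewrite ler_ln ?posrE ?ltr0n ?mulr_gt0 ?exprn_gt0 ?ltr0n //.
  by rewrite -!natrX -natrM ler_nat ltnW.
have hr : ln (r.+1%:R : R) <= 10 * ln 2 + r.+1%:R / 1024 - 1.
  have h : -1 < r.+1%:R / 1024 - 1 :> R by rewrite ltrBrDr addrC subrr divr_gt0.
  have := le_ln1Dx h; rewrite addrC subrK.
  have -> : 1024 = 2 ^+ 10 :> R by lra.
  rewrite ln_div ?posrE ?exprn_gt0 ?ltr0n // lnXn ?ltr0n // -(mulr_natl (ln _)).
  lra.
rewrite lnM ?posrE ?exprn_gt0 ?ltr0n // !lnXn ?ltr0n // -!(mulr_natl (ln _)) in hx.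
have : r.+1%:R / 1024 <= 2 * ln 2 * (r.+1%:R / 1024) :> R.
  by apply: ler_peMl; [rewrite divr_ge0 | lra].
move: hx hr; set a := ln r.+1%:R; set b := r.+1%:R; lra.
Qed.

(** In use [L = ln x], [l2 = ln 2], [h] is the common [inv_sum], [gp] and [gn] are the [log_sum]
    values, and 15 and 13 are the lengths of the lists. *)
Lemma growth_arith (R : realFieldType) (x r t L l2 E h gp gn lp lq : R) :
  1000 <= r -> 8 * r ^+ 2 <= x -> 1 / 2 <= l2 ->
  L + 1 <= l2 * (23 + 4 * (r + 1) / 1024) ->
  E <= r + x * t -> (429 / 1000 / 1000 + 2 * t) * l2 <= gn - gp ->
  x * ((L - 1) * h - gp) - 15 * (L + 1) <= lp ->
  lq <= x * ((L - 1) * h - gn) + 13 * (L + 1) ->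
  lq + E * (2 * l2) < lp.
Proof.
move=> hr hx l2_ge hL hE gap lo hi; rewrite ltNge; apply/negP => le_pq.
have key : x * (gn - gp) <= 28 * (L + 1) + E * (2 * l2) by lra.
have x0 : 0 < x by nra.
have h1 := ler_wpM2l (ltW x0) gap.
have h2 : E * (2 * l2) <= (r + x * t) * (2 * l2) by apply: ler_wpM2r => //; lra.
clear gap hE lo hi le_pq.
(* After division by [l2], the quadratic [8 r ^ 2 * 429 / 10^6] must beat a linear polynomial in
   [r], which it does from 1000 on. *)
have : x * (429 / 1000 / 1000) * l2 <= (28 * (23 + 4 * (r + 1) / 1024) + 2 * r) * l2 by lra.
rewrite ler_pM2r; last by lra.
clear -hr hx; nra.
Qed.

Lemma floor_factprod_growth (x r : nat) : (1000 <= r)%N ->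
  (8 * r ^ 2 <= x < 8 * r.+1 ^ 2)%N ->
  (floor_factprod neg_scales x *
    4 ^ (r + x %/ 856 + x %/ 2408 + 8 * (x %/ (24 * 1000))) <
  floor_factprod pos_scales x)%N.
Proof.
move=> ge_r /andP[lex ltx].
(* 450 is the largest scale, and every scale must be at most [x]. *)
have ge_x : (450 <= x)%N.
  by apply: leq_trans lex; apply: leq_trans (_ : 8 * 1000 <= _)%N; [|nia].
have all_pos : all (fun k => 0 < k <= x)%N pos_scales by rewrite /=; lia.
have all_neg : all (fun k => 0 < k <= x)%N neg_scales by rewrite /=; lia.
have x0 : (0 < x < 8 * r.+1 ^ 2)%N by rewrite ltx andbT; lia.
pose R : realType := Rdefinitions.R.
have /andP[lo _] := ln_floor_factprod_bounds R all_pos.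
have /andP[_ hi] := ln_floor_factprod_bounds R all_neg.
have lx := ln_lt_sqrt R x0.
have hr : 1000 <= r%:R :> R by rewrite ler_nat.
have hx : 8 * r%:R ^+ 2 <= x%:R :> R by rewrite -natrX -natrM ler_nat.
set E := (r + _ + _ + _)%N.
have hE : E%:R <= r%:R + x%:R * (1 / 856 + 1 / 2408 + 8 / (24 * 1000)) :> R.
  have floor_le d : (0 < d)%N -> (x %/ d)%:R <= x%:R / d%:R :> R.
    by move=> d0; rewrite ler_pdivlMr ?ltr0n // -natrM ler_nat leq_trunc_div.
  have eE : E%:R = r%:R + (x %/ 856)%:R + (x %/ 2408)%:R + 8 * (x %/ (24 * 1000))%:R :> R.
    by rewrite /E natrD natrD natrD natrM.
  have := floor_le 856%N isT; have := floor_le 2408%N isT.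
  have := floor_le (24 * 1000)%N isT; rewrite eE (natrM R 24); clear; lra.
have l4 : ln (4 ^+ E) = E%:R * (2 * ln 2) :> R.
  have -> : 4 = 2 ^+ 2 :> R by rewrite -natrX.
  by rewrite -exprM lnXn ?ltr0n // -[LHS]mulr_natl natrM; ring.
rewrite -[r.+1%:R]natr1 in lx; rewrite inv_sum_eq in lo.
have := growth_arith hr hx (ln2_ge_half R) lx hE (log_sum_gap_ge R) lo hi.
rewrite -l4 -lnM ?posrE ?exprn_gt0 ?ltr0n ?floor_factprod_gt0 //.
rewrite ltr_ln ?posrE ?mulr_gt0 ?exprn_gt0 ?ltr0n ?floor_factprod_gt0 //.
by rewrite -natrX -natrM ltr_nat.
Qed.

Local Close Scope ring_scope.

(** * Existence of the prime and conclusion *)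

Lemma prime_near_large n : 3 * (900 * 1000) <= n ->
  exists q, [/\ prime q, n < 3 * q & 8 * q <= 3 * n + 1].
Proof.
move=> ge_n; pose good q := [&& prime q, n < 3 * q & 8 * q <= 3 * n + 1].
have [/existsP[q /and3P[]]|none] := boolP [exists q : 'I_n.+1, good q].
  by exists (val q).
(* The threshold on [n] gives [3 * n %/ 8 >= 1012500], hence [r >= 1000]. *)
pose r := Nat.sqrt (3 * n %/ 8).
have [lo hi] := PeanoNat.Nat.sqrt_spec' (3 * n %/ 8).
rewrite -/r in lo hi.
have sq : 8 * r ^ 2 <= 3 * n < 8 * r.+1 ^ 2 by nia.
have ge_r : 1000 <= r by nia.
(* A prime with [8 * q <= 3 * n < 9 * q] would be good. *)
have noq q : prime q -> 8 * q <= 3 * n -> 9 * q <= 3 * n.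
  move=> pq le8; rewrite leqNgt; apply: contra none => lt9.
  have ltq : q < n.+1 by lia.
  apply/existsP; exists (Ordinal ltq); rewrite /good pq /=; lia.
have /andP[_ lt_sq] := sq.
have := floor_factprod_le noq lt_sq.
by rewrite leqNgt floor_factprod_growth.
Qed.

Lemma prime_near n : 58 < n -> n \notin small_range ->
  exists q, [/\ prime q, 2 < q, n < 3 * q & 8 * q <= 3 * n + 1].
Proof.
move=> gt_n; rewrite !mem_cat !mem_iota => not_small.
suff [q [pq lt_n le_n]] : exists q, [/\ prime q, n < 3 * q & 8 * q <= 3 * n + 1].
  by exists q; split=> //; lia.
case: (leqP 99 n) => [le99|lt99].
  case: (ltnP n (3 * (900 * 1000))); [exact: prime_near_small | exact: prime_near_large].
(* Outside [small_range], 23 serves 61 to 68, 29 serves 77 to 86, and 31 serves 87 to 92. *)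
case: (leqP n 68) => h1; first by exists 23; split=> //; lia.
case: (leqP n 86) => h2; first by exists 29; split=> //; lia.
by exists 31; split=> //; lia.
Qed.

(* Finitely many n with Fbar n integral, and the largest is 58:
   Fbar 58 is an integer and Fbar n is not an integer for every n > 58. *)
Theorem theorem4p11 :
  is_integer (Fbar 58) /\ (forall n : nat, (58 < n)%N -> ~ is_integer (Fbar n)).
Proof.
split=> [|n gt_n]; first exact: integer_Fbar58.
have [small|] := boolP (n \in small_range).
  exact: not_integer_Fbar (farey_ord_neg_small small).
by move=> /(prime_near gt_n)[p [pp p3 lt_n le_n]];
  apply: not_integer_Fbar (farey_ord_neg_prime pp p3 lt_n le_n).
Qed.
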